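(* Let $f_1,\dots,f_k$ be homeomorphisms of the circle $S^1$ without a common invariant probability measure and such that the IFS generated by them is forward minimal. Then $S^1$ is a strict attractor of this IFS.
   Context: A common invariant probability measure is a Borel probability measure $\nu$ on $S^1$ with $(f_i)_*\nu=\nu$ for all $i=1,\dots,k$. The IFS is forward minimal if the only non-empty closed set $B\subset S^1$ with $f_i(B)\subset B$ for all $i$ is $B=S^1$. $F(K)=\bigcup_{i=1}^k f_i(K)$ for non-empty compact $K\subset S^1$. $S^1$ is a strict attractor of the IFS if $\lim_{n\to\infty}F^n(K)=S^1$ in the Vietoris topology (equivalently, the Hausdorff metric) for all non-empty compact sets $K\subset S^1$. *)

(* Defs.v *)
From HB Require Import structures.
From mathcomp Require Import all_boot all_order all_algebra.
From mathcomp Require Import all_classical all_reals all_analysis.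

Set Implicit Arguments.
Unset Strict Implicit.
Unset Printing Implicit Defensive.

Import Order.TTheory GRing.Theory Num.Theory.
Import numFieldNormedType.Exports.

Local Open Scope classical_set_scope.
Local Open Scope ring_scope.

Definition unit_circle (R : realType) : set (R * R) :=
  [set p | p.1 ^+ 2 + p.2 ^+ 2 = 1].
Arguments unit_circle : clear implicits.

(* The topology is the one inherited from the plane. *)
Definition circle (R : realType) : Type := set_type (unit_circle R).

HB.instance Definition _ (R : realType) :=
  PseudoMetric.copy (circle R) (set_type (unit_circle R)).

Lemma unit_circle10 (R : realType) : (1, 0) \in unit_circle R.
Proof. by rewrite inE /unit_circle /= expr1n expr0n addr0. Qed.

(* [g_sigma_algebraType] is a measurable type only over a pointed type. *)
HB.instance Definition _ (R : realType) :=
  isPointed.Build (circle R) (exist _ (1, 0) (unit_circle10 R)).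

Definition homeomorphism (X Y : topologicalType) (f : X -> Y) : Prop :=
  continuous f /\
  exists g : Y -> X, [/\ cancel f g, cancel g f & continuous g].

Definition borel (X : ptopologicalType) := g_sigma_algebraType (@open X).

Definition common_invariant (R : realType) (X : ptopologicalType) (k : nat)
    (f : 'I_k -> X -> X) (nu : probability (borel X) R) : Prop :=
  forall (i : 'I_k) (A : set (borel X)),
    measurable A -> pushforward nu (f i : borel X -> borel X) A = nu A.

Definition forward_minimal (X : topologicalType) (k : nat)
    (f : 'I_k -> X -> X) : Prop :=
  forall B : set X, B !=set0 -> closed B ->
    (forall i : 'I_k, f i @` B `<=` B) -> B = setT.

Definition hutchinson (X : Type) (k : nat) (f : 'I_k -> X -> X)
    (K : set X) : set X :=
  \bigcup_(i in [set: 'I_k]) (f i @` K).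

(* The Vietoris topology is put on all subsets of X rather than on the
   hyperspace of non-empty compact subsets only; the latter carries the subspace
   topology, so convergence of a sequence of non-empty compact sets to a
   non-empty compact set is the same in both. *)
Definition vietoris (X : Type) : Type := set X.

HB.instance Definition _ (X : Type) := Choice.on (vietoris X).

Definition vietoris_subbase (X : topologicalType) : set (set (vietoris X)) :=
  [set [set K : set X | K `<=` U] | U in @open X] `|`
  [set [set K : set X | K `&` U !=set0] | U in @open X].

HB.instance Definition _ (X : topologicalType) :=
  isSubBaseTopological.Build (vietoris X) (@vietoris_subbase X) id.

Definition strict_attractor (X : topologicalType) (k : nat)
    (f : 'I_k -> X -> X) (A : set X) : Prop :=
  forall K : set X, K !=set0 -> compact K ->
    (fun n => iter n (hutchinson f) K : vietoris X) @ \oo --> (A : vietoris X).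

(* Main.v *)
(* If some non-empty open set [U] has images of arbitrarily small diameter
   under the semigroup, then minimality gives words mapping [U] into itself
   with image as small as desired. Composing them with powers of one such
   word, of length [m], produces points which, for every large [n], are
   approached by images of [U] under words of length [n * m]. These points
   form a closed set invariant under words of length [m]; since the circle is
   connected, minimality passes to words of length [m], so this set is the
   whole circle.
   If there is no such [U], then the inverse semigroup is equicontinuous,
   because a non-degenerate arc contains one of finitely many open sets and
   two close points bound a small arc. An ultralimit of normalized covering
   numbers by sets that stay small under the inverse semigroup is then a
   content [lam] with [lam (f_i^-1 A) <= lam A]. It extends to a Borel
   probability measure with the same inequality, which is an equality by
   passing to complements. *)
Require Import Defs.
From HB Require Import structures.
From mathcomp Require Import all_boot all_order all_algebra.
From mathcomp Require Import all_classical all_reals all_analysis.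
From mathcomp Require Import finmap ring lra.

Set Implicit Arguments.
Unset Strict Implicit.
Unset Printing Implicit Defensive.

Import Order.TTheory GRing.Theory Num.Theory.
Import numFieldNormedType.Exports.

Local Open Scope classical_set_scope.
Local Open Scope ring_scope.

(** * Words, and minimality under words of fixed length *)

Section word_action.
Context (X : Type) (k : nat) (f : 'I_k -> X -> X).

Definition word_action (w : seq 'I_k) (x : X) : X :=
  foldl (fun y i => f i y) x w.

Lemma word_action_cat u v x :
  word_action (u ++ v) x = word_action v (word_action u x).
Proof. exact: foldl_cat. Qed.

Lemma word_action_rcons w i x :
  word_action (rcons w i) x = f i (word_action w x).
Proof. by rewrite /word_action -cats1 foldl_cat. Qed.

Lemma iter_hutchinsonP n K y : iter n (hutchinson f) K y <->
  exists w x, [/\ size w = n, K x & word_action w x = y].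
Proof.
elim: n y => [|n IH] y.
  split=> [Ky|[w [x [/size0nil -> Kx <-]]] //]; by exists [::], y.
split=> [[i _ [z /IH[w [x [sw Kx <-]]] <-]]|[w [x [+ Kx <-]]]].
  by exists (rcons w i), x; rewrite size_rcons sw word_action_rcons.
case/lastP: w => // w i; rewrite size_rcons => -[sw].
rewrite word_action_rcons; exists i => //; exists (word_action w x) => //.
by apply/IH; exists w, x.
Qed.

End word_action.

Lemma word_action_homeomorphism (X : topologicalType) (k : nat)
    (f : 'I_k -> X -> X) w :
  (forall i, homeomorphism (f i)) -> homeomorphism (word_action f w).
Proof.
move=> fh; elim/last_ind: w => [|w i [cw [v [wv vw cv]]]].
  split; first by move=> x; exact: cvg_id.
  by exists id; split=> // x; exact: cvg_id.
have [ci [g [fg gf cg]]] := fh i.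
have fE : word_action f (rcons w i) = f i \o word_action f w.
  by apply/funext => x; exact: word_action_rcons.
split.
  by rewrite fE => x; apply: continuous_comp; [exact: cw | exact: ci].
exists (v \o g); rewrite fE; split.
- exact: can_comp.
- exact: can_comp.
- by move=> x; apply: continuous_comp; [exact: cg | exact: cv].
Qed.

Section hutchinson_topology.
Context (X : ptopologicalType) (k : nat) (f : 'I_k -> X -> X).
Local Notation H := (hutchinson f).

Lemma iter_hutchinson_homo n A B : A `<=` B -> iter n H A `<=` iter n H B.
Proof.
move=> AB; elim: n => // n IH y [i _ [x /IH Bx <-]].
by exists i => //; exists x.
Qed.

(** Forward minimality of the IFS whose maps are the compositions of exactly [m] of the [f i]. *)
Definition minimal_in_steps (m : nat) := forall B : set X,
  B !=set0 -> closed B -> iter m H B `<=` B -> B = setT.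

(** The closure of the orbit of [x] under words of length divisible by [m] is, by continuity, stable
    under [iter m H]; minimality makes it the whole space. *)
Lemma minimal_in_steps_hits m x (V : set X) :
  (forall i, continuous (f i)) -> minimal_in_steps m -> open V -> V !=set0 ->
  exists u n, size u = (n * m)%N /\ V (word_action f u x).
Proof.
move=> cf minm oV [y Vy].
pose A := \bigcup_n iter (n * m) H [set x].
have H_closure (B : set X) n : iter n H (closure B) `<=` closure (iter n H B).
  elim: n => // n IH z [i _ [t /IH Bt <-]] W Wft.
  have [s [Bs Ws]] := Bt _ (cf i _ _ Wft).
  by exists (f i s); split=> //; exists i => //; exists s.
have AT : closure A = setT.
  apply: minm; last 1 first.
  - move=> z /H_closure; apply: closureS => {}z.
    move=> /iter_hutchinsonP[u [t [um [n _ At] <-]]].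
    exists n.+1 => //; rewrite mulSn iterD; apply/iter_hutchinsonP.
    by exists u, t.
  - by exists x; apply: subset_closure; exists 0%N.
  - exact: closed_closure.
have : closure A y by rewrite AT.
move=> /(_ V (open_nbhs_nbhs (conj oV Vy)))[z [[n _]]].
by move=> /iter_hutchinsonP[u [_ [um -> <-]]] Vz; exists u, n.
Qed.

(** Zorn's lemma for the complements. The union of a chain of them stays proper: otherwise, by
    compactness, finitely many members would cover [X], hence the largest of these would. *)
Lemma minimal_set_exists m : compact [set: X] -> exists M : set X,
  [/\ M !=set0, closed M, iter m H M `<=` M &
  forall B, B !=set0 -> closed B -> iter m H B `<=` B -> B `<=` M -> B = M].
Proof.
move=> cX.
pose P := [set G : set X |
  [/\ open G, G != setT & iter m H (~` G) `<=` ~` G]].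
have [F FP Ftot|G [[oO OT HO] Omax]] := @Zorn_bigcup X P.
  split.
  - by apply: bigcup_open => G /FP[].
  - apply/negP => /eqP FT; move: cX; rewrite compact_cover.
    move=> /(_ _ F id) []; [by move=> G /FP[]|by rewrite /cover FT|].
    move=> D DF XD.
    have [G FO OD] : exists2 G, F G &
        forall G', G' \in finmap.enum_fset D -> G' `<=` G.
      have : {in finmap.enum_fset D, forall G, F G} by move=> G /DF /set_mem.
      suff : finmap.enum_fset D != [::] ->
        {in finmap.enum_fset D, forall G, F G} ->
        exists2 G, F G & {in finmap.enum_fset D, forall G', G' `<=` G}.
        apply; apply/eqP => D0; have [G /= + _] := XD point I.
        by rewrite -[_ \in _]/(G \in finmap.enum_fset D) D0.
      elim: (finmap.enum_fset D) => // G s IH _ sF.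
      have FO : F G by apply: sF; rewrite mem_head.
      have [s0|/IH[|G' FO' sO']] := eqVneq s [::].
      + by exists G => // G'; rewrite s0 inE => /eqP ->.
      + by move=> G'' Os; apply: sF; rewrite inE Os orbT.
      + have [OO|OO] := Ftot _ _ FO FO'.
          by exists G' => // G''; rewrite inE => /predU1P[->|/sO'].
        exists G => // G''; rewrite inE => /predU1P[-> //|/sO' G'G].
        exact: subset_trans OO.
    have [_ /eqP nOT _] := FP _ FO; apply: nOT; apply/seteqP; split=> // x.
    by move=> /XD[G' /= /OD]; apply.
  - move=> x Hx [G FO Ox]; have [_ _ HO] := FP _ FO.
    move: Ox; apply: HO; apply: iter_hutchinson_homo Hx.
    by apply: subsetC => y Oy; exists G.
exists (~` G); split=> //.
- apply/set0P/eqP => G0; move/eqP: OT; apply.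
  by rewrite -[G]setCK G0 setC0.
- exact: open_closedC.
move=> B B0 cB HB BO; apply: contrapT => BnO.
apply: (Omax (~` B)).
  split; first by rewrite -[G]setCK; exact: subsetC.
  move=> BG; apply: BnO; apply/seteqP; split=> // x nGx.
  by apply: contrapT => /BG.
split.
- exact: closed_openC.
- by apply/eqP => BT; case: B0 => x Bx; have : (~` B) x by rewrite BT.
- by rewrite setCK.
Qed.

Lemma iter_hutchinson_closed n K : (forall i, homeomorphism (f i)) ->
  closed K -> closed (iter n H K).
Proof.
move=> fh cK; elim: n => // n IH; apply: closed_bigcup => [|i _].
  exact: finite_finset.
have [_ [g [fg gf cg]]] := fh i.
have -> : f i @` iter n H K = g @^-1` iter n H K.
  apply/seteqP; split=> [_ [x Kx <-] /=|y Ky]; first by rewrite fg.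
  by exists (g y).
by apply: preimage_closed => // x _; exact: cg.
Qed.

(** The images [iter j H M], [j < d], of a minimal closed set [M] for words of length [d] cover [X]
    by forward minimality. One that meets [M] lies in [M], so [M] is the complement of a finite
    union of closed sets; being clopen in a connected space, it is everything. *)
Lemma minimal_in_steps_of_connected d : compact [set: X] ->
  connected [set: X] -> (forall i, homeomorphism (f i)) ->
  forward_minimal f -> (0 < d)%N -> minimal_in_steps d.
Proof.
move=> cX connX fh fmin d0.
have [M [M0 cM HM Mmin]] := @minimal_set_exists d cX.
have cHM j : closed (iter j H M) by exact: iter_hutchinson_closed.
have HdMj j : iter d H (iter j H M) `<=` iter j H M.
  by rewrite -iterD addnC iterD; exact: iter_hutchinson_homo.
have cover_M : \bigcup_(j < d) iter j H M = setT.
  apply: fmin.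
  - by case: M0 => x Mx; exists x; exists 0%N.
  - by apply: closed_bigcup => //; exact: finite_II.
  - move=> i _ [x [j jd Mx] <-].
    have Mfx : iter j.+1 H M (f i x) by exists i => //; exists x.
    have [jd'|] := ltnP j.+1 d; first by exists j.+1.
    rewrite leq_eqVlt ltnS leqNgt jd orbF => /eqP dj.
    by exists 0%N => //; apply: HM; rewrite dj.
have HM_sub j : M `&` iter j H M !=set0 -> iter j H M `<=` M.
  move=> MMj0.
  have /seteqP[_ MsubMj] : M `&` iter j H M = M.
    apply: Mmin => //.
    - exact: closedI.
    - move=> x Hx; split.
        by apply: HM; apply: iter_hutchinson_homo Hx; exact: subIsetl.
      by apply: HdMj; apply: iter_hutchinson_homo Hx; exact: subIsetr.
  have Msub n : M `<=` iter (n * j) H M.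
    elim: n => // n IH; rewrite mulSn addnC iterD => x /IH.
    by apply: iter_hutchinson_homo => y /MsubMj[].
  have subM n : iter (n * d) H M `<=` M.
    elim: n => // n IH; rewrite mulSn addnC iterD => x Hx; apply: IH.
    by apply: iter_hutchinson_homo Hx.
  (* [M] lies in [iter (d.-1 * j) H M]; applying [iter j H] puts [iter j H M] inside
     [iter (d * j) H M], hence inside [M]. *)
  move=> x Hx; apply: (subM j); rewrite mulnC -(prednK d0) mulSn iterD.
  by apply: iter_hutchinson_homo Hx; exact: Msub.
pose C := \bigcup_(j in [set j | (j < d)%N /\ M `&` iter j H M = set0])
  iter j H M.
have cC : closed C.
  apply: closed_bigcup => //; apply: sub_finite_set (finite_II d).
  by move=> j [].
have MC : M = ~` C.
  apply/seteqP; split=> [x Mx [j [_ MMj] Mjx]|x Cx].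
    by have : (M `&` iter j H M) x by []; rewrite MMj.
  have : (\bigcup_(j < d) iter j H M) x by rewrite cover_M.
  case=> j jd Mjx; apply: (HM_sub j) => //; apply/set0P/eqP => MMj.
  by apply: Cx; exists j.
have MT : M = setT.
  apply: connX => //.
    by exists M; [rewrite MC; exact: closed_openC | rewrite setTI].
  by exists M => //; rewrite setTI.
by move=> B B0 cB HB; rewrite -MT; apply: Mmin => //; rewrite MT.
Qed.

End hutchinson_topology.

(** A sub-basic condition of inclusion in [U] that holds for the whole space forces [U = setT] and
    is then trivial; only the finitely many hitting conditions of a basic neighbourhood remain. *)
Lemma vietoris_cvg_setT (X : topologicalType) (A : nat -> set X) :
  (forall V : set X, open V -> V !=set0 ->
    \forall n \near \oo, A n `&` V !=set0) ->
  (A : nat -> vietoris X) @ \oo --> ([set: X] : vietoris X).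
Proof.
move=> AV W; rewrite nbhsE => -[G [oO OT] OW]; apply: filterS OW _.
move: oO OT => [D DF <-] [B DB BT].
have [E ED EB] := DF _ DB.
have {}EB : \bigcap_(i in [set` E]) i = B by [].
have : eventually
    (\bigcap_(C in [set` E]) [set n | (C : set (vietoris X)) (A n)]).
  apply: (@filter_bigI _ _ _ _ eventually) => C CE.
  have : (C : set (vietoris X)) [set: X] by move: BT; rewrite -EB; exact.
  have /set_mem [[U oU <-]|[U oU <-]] := ED _ CE.
    by move=> TU; exists 0%N => // n _; exact: subset_trans TU.
  by rewrite /= setTI => U0; exact: AV.
by apply: filterS => n EA; exists B => //; rewrite -EB.
Qed.

(** * Contracted open sets *)

Lemma cluster_of_seq (X : topologicalType) (z : nat -> X) :
  compact [set: X] -> exists p : X, forall V, nbhs p V -> forall N,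
    exists2 n, (N <= n)%N & V (z n).
Proof.
move=> cX; have [|p [_ zp]] := cX (z @ \oo) _; first exact: filterT.
exists p => V pV N.
have [|y [[n /= Nn <-] Vy]] := zp (z @` [set n | (N <= n)%N]) V _ pV.
  by exists N => // n Nn; exists n.
by exists n.
Qed.

Section contraction.
Context (R : realType) (X : pseudoPMetricType R) (k : nat).
Context (f : 'I_k -> X -> X) (i0 : 'I_k) (U : set X).
Hypothesis X_compact : compact [set: X].
Hypothesis X_connected : connected [set: X].
Hypothesis f_homeo : forall i, homeomorphism (f i).
Hypothesis f_minimal : forward_minimal f.
Hypothesis U_open : open U.
Hypothesis U_contracted : forall e : R, 0 < e ->
  exists w, forall x y, U x -> U y ->
  ball (word_action f w x) e (word_action f w y).
Local Notation H := (hutchinson f).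

Let word_cont w : continuous (word_action f w).
Proof. by have [] := word_action_homeomorphism w f_homeo. Qed.

Let minimal m : (0 < m)%N -> minimal_in_steps f m.
Proof. exact: minimal_in_steps_of_connected. Qed.

Let hits m x V : (0 < m)%N -> open V -> V !=set0 ->
  exists u n, size u = (n * m)%N /\ V (word_action f u x).
Proof.
move=> m0; apply: minimal_in_steps_hits; last exact: minimal.
by move=> i; have [] := f_homeo i.
Qed.

(** Meant for [y] the image of a base point and [z] any other point of the same image of [U]: a
    small image that comes near [p] lies entirely in [V]. *)
Let near_ball (p : X) V : nbhs p V -> exists N, forall n y z, (N <= n)%N ->
  ball p N.+1%:R^-1 y -> ball y n.+1%:R^-1 z -> V z.
Proof.
case/nbhs_ballP => e /= e0 pV; have e20 : 0 < e / 2 by rewrite divr_gt0.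
have [N _ Ne] := near_infty_natSinv_lt (PosNum e20).
exists N => n y z Nn py yz; apply: pV; rewrite [e]splitr.
apply: (ball_triangle (y := y)).
  by apply: le_ball py; apply/ltW/Ne => /=.
by apply: le_ball yz; apply/ltW/Ne.
Qed.

(** Contracting words send [x0] close to a cluster point [p]. By minimality some word carries a
    neighbourhood of [p] into a small part of [U]; appending it to a sufficiently contracting word
    yields [v]. *)
Lemma contracted_into_itself x0 (e : R) : U x0 -> 0 < e -> exists v,
  [/\ (0 < size v)%N, forall x, U x -> U (word_action f v x) &
   forall x y, U x -> U y -> ball (word_action f v x) e (word_action f v y)].
Proof.
move=> Ux0 e0.
have /choice[w wU] n : exists w, forall x y, U x -> U y ->
  ball (word_action f w x) n.+1%:R^-1 (word_action f w y) by exact: U_contracted.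
have [p wp] := cluster_of_seq (fun n => word_action f (w n) x0) X_compact.
(* Starting from [f i0 p] makes the appended word [i0 :: u] non-empty. *)
have [u [n [_ Uu]]] := @hits 1 (f i0 p) U (ltnSn 0) U_open (ex_intro _ _ Ux0).
pose q := word_action f (i0 :: u) p.
have pV : nbhs p (word_action f (i0 :: u) @^-1` (U `&` ball q (e / 2))).
  suff : nbhs q (U `&` ball q (e / 2)) by move/word_cont.
  apply: filterI; first exact: open_nbhs_nbhs.
  by apply: nbhsx_ballx; rewrite divr_gt0.
have [N HN] := near_ball pV.
have pN : nbhs p (ball p N.+1%:R^-1) by exact: nbhsx_ballx.
have [m Nm wm] := wp _ pN N.
have VU x : U x -> (U `&` ball q (e / 2)) (word_action f (w m ++ i0 :: u) x).
  by move=> Ux; rewrite word_action_cat; apply: (HN m) wm _ => //; exact: wU.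
exists (w m ++ i0 :: u); split.
- by rewrite size_cat /= addnS.
- by move=> x /VU[].
- move=> x y /VU[_ qx] /VU[_ qy]; rewrite [e]splitr.
  by apply: ball_triangle qy; exact: ball_sym.
Qed.

Let word_pow_stable g n x : (forall x, U x -> U (word_action f g x)) ->
  U x -> U (word_action f (flatten (nseq n g)) x).
Proof.
move=> gU; elim: n x => // n IH x Ux /=.
by rewrite word_action_cat; apply: IH; exact: gU.
Qed.

Let size_word_pow (g : seq 'I_k) n : size (flatten (nseq n g)) = (n * size g)%N.
Proof. by elim: n => // n IH; rewrite /= size_cat IH mulSn. Qed.

(** A strong form of lower limit: a single word must send all of [U] into [V], so that it can follow
    any word that reaches [U]. *)
Definition eventual_images (m : nat) : set X := [set y | forall V, nbhs y V ->
  \forall n \near \oo, exists2 w, size w = (n * m)%N &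
    forall x, U x -> V (word_action f w x)].

(** This set is closed and stable under words of length [m], so by minimality for such words one
    point in it suffices. The period [m] is the length of a word [g] mapping [U] into itself. *)
Lemma eventual_images_setT x0 : U x0 ->
  exists2 m, (0 < m)%N & eventual_images m = setT.
Proof.
move=> Ux0; have [g [g0 gU _]] := contracted_into_itself Ux0 ltr01.
exists (size g) => //; set m := size g.
apply: (@minimal m) => //.
- have inv_gt0 n : 0 < n.+1%:R^-1 :> R by [].
  have [v vP] := choice (fun n => contracted_into_itself Ux0 (inv_gt0 n)).
  have [q vq] := cluster_of_seq (fun n => word_action f (v n) x0) X_compact.
  exists q => V /near_ball[N HN].
  have qN : nbhs q (ball q N.+1%:R^-1) by exact: nbhsx_ballx.
  have [j Nj vj] := vq _ qN N.
  have [vj0 vjU vjB] := vP j.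
  near=> n.
  have jn : (size (v j) <= n)%N by near: n; exact: nbhs_infty_ge.
  (* The blocks have lengths [(n - size (v j)) * m], [m.-1 * size (v j)] and [size (v j)], of sum
     [n * m]. The first two keep points in [U]; the last sends [U] into [V]. *)
  exists (flatten (nseq (n - size (v j)) g) ++ flatten (nseq m.-1 (v j)) ++ v j).
    rewrite !size_cat !size_word_pow -mulSnr prednK // -/m.
    by rewrite mulnC -mulnDr addnC subnKC // mulnC.
  move=> x Ux; rewrite !word_action_cat; apply: (HN j) vj _ => //.
  by apply: vjB => //; apply: word_pow_stable => //; exact: word_pow_stable.
- move=> y yL V; rewrite nbhsE => -[W [oW Wy] WV].
  have [z [Lz Wz]] := yL W (open_nbhs_nbhs (conj oW Wy)).
  apply: filterS (Lz W (open_nbhs_nbhs (conj oW Wz))) => n [w wn wW].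
  by exists w => // x Ux; apply/WV/wW.
- move=> y /iter_hutchinsonP[u [z [um Lz <-]]] V uzV.
  have [N _ HN] := Lz _ (word_cont uzV).
  exists N.+1 => // -[//|n] /HN[w wn wV]; exists (w ++ u).
    by rewrite size_cat wn um mulSnr.
  by move=> x /wV; rewrite word_action_cat.
Unshelve. all: by end_near. Qed.

(** The length [n] is divided by [m]: [r] letters [i0] absorb the remainder, a word of length
    divisible by [m] then leads into [U], and a word of the exact length left over carries [U] into
    [V]. *)
Lemma strict_attractor_of_contraction : U !=set0 -> strict_attractor f setT.
Proof.
move=> [x0 Ux0] K [x Kx] _; apply: vietoris_cvg_setT => V oV [y Vy].
have [m m0 imT] := eventual_images_setT Ux0.
have : eventual_images m y by rewrite imT.
move=> /(_ V (open_nbhs_nbhs (conj oV Vy)))[N _ HN].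
have /choice[u uP] r : exists u : seq 'I_k, (exists n, size u = (n * m)%N) /\
    U (word_action f u (word_action f (nseq r i0) x)).
  have [u [n [un Uu]]] := hits (word_action f (nseq r i0) x) m0 U_open
    (ex_intro _ _ Ux0).
  by exists u; split=> //; exists n.
pose M := (\max_(r < m) size (u r))%N.
(* [M] bounds the quotient [size (u r) %/ m] for every residue [r], so at least [N] blocks of length
   [m] are left for the last word. *)
exists ((N + M).+1 * m)%N => // n /= Mn.
pose r := (n %% m)%N.
have rm : (r < m)%N by rewrite ltn_mod.
have [[q uq] Uu] := uP r.
have qM : (q <= M)%N.
  apply: leq_trans (leq_bigmax (Ordinal rm)) => /=.
  by rewrite uq leq_pmulr.
have NM : (N + q <= n %/ m)%N.
  rewrite leq_divRL //; apply: leq_trans Mn; rewrite leq_mul2r.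
  by apply/orP; right; apply: leqW; rewrite leq_add2l.
have qn : (q <= n %/ m)%N by apply: leq_trans NM; exact: leq_addl.
have /HN[w ws wV] : (N <= n %/ m - q)%N by rewrite -(leq_add2r q) subnK.
exists (word_action f (nseq r i0 ++ u r ++ w) x); split.
  apply/iter_hutchinsonP; exists (nseq r i0 ++ u r ++ w), x; split=> //.
  by rewrite !size_cat size_nseq uq ws -mulnDl subnKC // addnC -divn_eq.
by rewrite !word_action_cat; exact: wV.
Qed.

End contraction.

(** * Invariant probability measures of equicontinuous systems *)

Section covering_number.
Context (X : Type) (S : set (set X)).
Hypothesis S_fin : exists s : seq (set X),
  {in s, forall C, S C} /\ [set: X] `<=` \bigcup_(C in [set` s]) C.

Definition covered (A : set X) (n : nat) := exists s : seq (set X),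
  [/\ size s = n, {in s, forall C, S C} & A `<=` \bigcup_(C in [set` s]) C].

(** The default 0 of [xget] is not reached when finitely many members of [S] cover [X]. *)
Definition covering_number (A : set X) : nat :=
  xget 0%N [set n | covered A n /\ forall m, covered A m -> (n <= m)%N].

Lemma covering_numberP A : covered A (covering_number A) /\
  forall m, covered A m -> (covering_number A <= m)%N.
Proof.
rewrite /covering_number; case: xgetP => [n -> //|none].
have [s [sS sX]] := S_fin.
have cA : exists n, `[< covered A n >].
  exists (size s); apply/asboolP; exists s; split=> // x _; exact: sX.
case: (ex_minnP cA) => m /asboolP cm mmin.
by case: (none m); split=> // i ci; apply: mmin; exact/asboolP.
Qed.

Lemma covering_number_min A m : covered A m -> (covering_number A <= m)%N.
Proof. by case: (covering_numberP A) => _; apply. Qed.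

Lemma covering_number0 : covering_number set0 = 0%N.
Proof.
apply/eqP; rewrite -leqn0; apply: covering_number_min.
by exists [::]; split=> //; exact: sub0set.
Qed.

Lemma covering_number_gt0 : [set: X] !=set0 -> (0 < covering_number setT)%N.
Proof.
case=> x _; have [[s [+ _ sX]] _] := covering_numberP setT.
by have [C /=] := sX x I; case: s {sX} => // D s _ _ <-.
Qed.

Lemma le_covering_number A B : A `<=` B ->
  (covering_number A <= covering_number B)%N.
Proof.
move=> AB; have [[s [sz sS sB]] _] := covering_numberP B.
by apply: covering_number_min; exists s; split=> //; exact: subset_trans sB.
Qed.

Lemma covering_numberU A B :
  (covering_number (A `|` B) <= covering_number A + covering_number B)%N.
Proof.
have [[s [szs sS sA]] _] := covering_numberP A.
have [[t [szt tS tB]] _] := covering_numberP B.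
apply: covering_number_min; exists (s ++ t); split.
- by rewrite size_cat szs szt.
- by move=> C; rewrite mem_cat => /orP[/sS|/tS].
- move=> x [/sA|/tB] [C /= Cs Cx]; exists C => //=; rewrite mem_cat Cs //.
  by rewrite orbT.
Qed.

(** In an optimal cover of the union, the members meeting [A] cover [A]; they miss [B], so the
    remaining ones cover [B]. *)
Lemma covering_number_separated A B :
  (forall C, S C -> C `&` A !=set0 -> C `&` B = set0) ->
  (covering_number A + covering_number B <= covering_number (A `|` B))%N.
Proof.
move=> sepAB; have [[s [<- sS sAB]] _] := covering_numberP (A `|` B).
pose a (C : set X) := `[< C `&` A !=set0 >].
rewrite -(count_predC a s) -!size_filter leq_add //;
  apply: covering_number_min; eexists; split=> //.
- by move=> C; rewrite mem_filter => /andP[_ /sS].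
- move=> x Ax; have [C /= Cs Cx] := sAB x (or_introl Ax).
  by exists C => //=; rewrite mem_filter Cs andbT; apply/asboolP; exists x.
- by move=> C; rewrite mem_filter => /andP[_ /sS].
- move=> x Bx; have [C /= Cs Cx] := sAB x (or_intror Bx).
  exists C => //=; rewrite mem_filter Cs andbT /=; apply/negP => /asboolP CA.
  have := sepAB C (sS _ Cs) CA; move/seteqP => [+ _] => /(_ x).
  by apply.
Qed.

Lemma covering_number_preimage (g : X -> X) A :
  (forall C, S C -> S (g @^-1` C)) ->
  (covering_number (g @^-1` A) <= covering_number A)%N.
Proof.
move=> gS; have [[s [sz sS sA]] _] := covering_numberP A.
apply: covering_number_min; exists [seq g @^-1` C | C <- s]; split.
- by rewrite size_map.
- by move=> D /mapP[C /sS SC ->]; exact: gS.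
- move=> x /sA [C /= Cs Cx]; exists (g @^-1` C) => //=.
  by apply/mapP; exists C.
Qed.

End covering_number.

(** Compactness gives a cluster point; an ultrafilter contains each set or its complement, so the
    cluster point is a limit. *)
Lemma ultra_cvg_itv (R : realType) (T : Type) (F : set_system T) (u : T -> R) :
  UltraFilter F -> (forall n, 0 <= u n <= 1) -> cvg (u n @[n --> F]).
Proof.
move=> FU u01.
have [|l [_ ul]] := @segment_compact R 0 1 (u @ F) _.
  by apply: (@filterS _ F _ setT _ _ filterT) => n _ /=; rewrite in_itv /=.
apply/cvg_ex; exists l => V lV.
have [//|FV] := in_ultra_setVsetC (u @^-1` V) FU.
by have [x []] := ul (~` V) V FV lV.
Qed.

(** * A content as an ultralimit of covering numbers *)

Section content.
Context (R : realType) (X : pseudoPMetricType R) (S : R -> set (set X)).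
Hypothesis S_ball : forall e C x y, S e C -> C x -> C y -> ball x e y.
Hypothesis S_fin : forall e, 0 < e -> exists s : seq (set X),
  {in s, forall C, S e C} /\ [set: X] `<=` \bigcup_(C in [set` s]) C.

Lemma content_exists : exists lam : set X -> R,
  [/\ lam set0 = 0, lam setT = 1,
      {homo lam : A B / A `<=` B >-> A <= B},
      (forall A B, lam (A `|` B) <= lam A + lam B) &
      (forall e A B, 0 < e -> (forall x y, A x -> B y -> ~ ball x e y) ->
        lam A + lam B <= lam (A `|` B)) /\
      (forall g : X -> X, (forall e C, S e C -> S e (g @^-1` C)) ->
        forall A, lam (g @^-1` A) <= lam A)].
Proof.
(* As [F] refines the eventual filter, inequalities valid for large [n] pass to the limit. *)
have [F [FU oF]] := ultraFilterLemma (eventually_filter : ProperFilter \oo).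
pose c (n : nat) := covering_number (S n.+1%:R^-1).
have fin n := S_fin (_ : 0 < n.+1%:R^-1 :> R).
have {}fin n : exists s : seq (set X), {in s, forall C, S n.+1%:R^-1 C} /\
  [set: X] `<=` \bigcup_(C in [set` s]) C by apply: fin.
have cT n : 0 < (c n setT)%:R :> R.
  by rewrite ltr0n; apply: covering_number_gt0 => //; exists point.
pose r A n : R := (c n A)%:R / (c n setT)%:R.
have r01 A n : 0 <= r A n <= 1.
  rewrite divr_ge0 //= ler_pdivrMr // mul1r ler_nat.
  exact: le_covering_number.
have cr A : cvg (r A n @[n --> F]) by exact: ultra_cvg_itv.
pose lam A := lim (r A n @[n --> F]).
have le_lam A (u : nat -> R) l : u n @[n --> F] --> l ->
    (\forall n \near \oo, r A n <= u n) -> lam A <= l.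
  move=> ul ru; rewrite -(cvg_lim _ ul) //; apply: ler_lim => //.
    by apply/cvg_ex; exists l.
  exact: oF.
exists lam; split.
- apply: cvg_lim => //; apply: cvg_near_cst; apply: nearW => n.
  by rewrite /r /c covering_number0 // mul0r.
- apply: cvg_lim => //; apply: cvg_near_cst; apply: nearW => n.
  by rewrite /r divff // gt_eqF.
- move=> A B AB; apply: le_lam; first exact: cr.
  apply: nearW => n; rewrite ler_pM2r ?invr_gt0 // ler_nat.
  exact: le_covering_number.
- move=> A B; apply: le_lam; first exact: (cvgD (cr A) (cr B)).
  apply: nearW => n /=; rewrite -mulrDl ler_pM2r ?invr_gt0 // -natrD ler_nat.
  exact: covering_numberU.
- split=> [e A B e0 sepAB|g gS A].
    rewrite /lam -limD //; apply: ler_lim => //.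
      by apply: is_cvgD.
    apply: oF; near=> n.
    rewrite -[leLHS]/(r A n + r B n) /r -mulrDl ler_pM2r ?invr_gt0 //.
    rewrite -natrD ler_nat.
    apply: covering_number_separated => // C SC [x [Cx Ax]].
    (* Two points of [C] are within [1/(n+1)], which is below [e] for large [n], so [C] cannot meet
       both [A] and [B]. *)
    rewrite -subset0 => y [Cy By]; apply: (sepAB x y Ax By).
    apply: le_ball (S_ball SC Cx Cy); apply/ltW.
    by near: n; exact: near_infty_natSinv_lt (PosNum e0).
  apply: le_lam; first exact: cr.
  apply: nearW => n; rewrite ler_pM2r ?invr_gt0 // ler_nat.
  by apply: covering_number_preimage => // C; exact: gS.
Unshelve. all: by end_near. Qed.

End content.

(** * Borel probability measures from outer measures *)

Section borel_measure_of_outer.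
Context (R : realType) (X : ptopologicalType).
Variable mu : {outer_measure set X -> \bar R}.
Hypothesis open_cara : @open X `<=` caratheodory_measurable mu.
Hypothesis muT : mu setT = 1%E.

Let sub_cara (A : set (borel X)) : measurable A -> caratheodory_measurable mu A.
Proof.
have sig : sigma_algebra setT (caratheodory_measurable mu).
  split.
  - exact: caratheodory_measurable_set0.
  - by move=> B mB; rewrite setTD; exact: caratheodory_measurable_setC.
  - by move=> F mF; exact: caratheodory_measurable_bigcup.
by apply: smallest_sub.
Qed.

Let nu : set (borel X) -> \bar R := mu.

Let nu0 : nu set0 = 0%E. Proof. exact: outer_measure0. Qed.

Let nu_ge0 A : (0 <= nu A)%E. Proof. exact: outer_measure_ge0. Qed.

Let nu_sigma_additive : semi_sigma_additive nu.
Proof.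
move=> F mF tF mUF; apply: caratheodory_measure_sigma_additive => //.
  by move=> i; exact: sub_cara.
exact: sub_cara.
Qed.

HB.instance Definition _ :=
  isMeasure.Build _ _ _ nu nu0 nu_ge0 nu_sigma_additive.

HB.instance Definition _ := Measure_isProbability.Build _ _ _ nu muT.

Lemma borel_probability_of_outer :
  exists P : probability (borel X) R, forall A : set X, P A = mu A.
Proof. by exists nu. Qed.

End borel_measure_of_outer.

(** * Extension of a content to a Borel measure *)

Section regular_extension.
Context (R : realType) (X : pseudoPMetricType R) (lam : set X -> R).
Hypothesis X_compact : compact [set: X].
Hypothesis lam0 : lam set0 = 0.
Hypothesis lamT : lam setT = 1.
Hypothesis lam_homo : {homo lam : A B / A `<=` B >-> A <= B}.
Hypothesis lamU : forall A B, lam (A `|` B) <= lam A + lam B.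
Hypothesis lam_separated : forall e A B, 0 < e ->
  (forall x y, A x -> B y -> ~ ball x e y) -> lam A + lam B <= lam (A `|` B).

Definition well_inside (V K : set X) :=
  exists2 r : R, 0 < r & forall x, K x -> ball x r `<=` V.

(** Inner content: only sets with a uniform margin count, since [lam] is superadditive only on sets
    a positive distance apart. *)
Let inner (V : set X) : \bar R := ereal_sup [set (lam K)%:E | K in well_inside V].

(* The value +oo on non-open sets restricts the covers that compete in [mu_ext]
   to open ones. *)
Let gauge (V : set X) : \bar R := if `[< open V >] then inner V else +oo%E.

Let lam_ge0 A : 0 <= lam A.
Proof. by rewrite -lam0; apply: lam_homo. Qed.

Let well_inside0 V : well_inside V set0.
Proof. by exists 1. Qed.

Let inner_ge0 V : (0 <= inner V)%E.
Proof.
apply: ereal_sup_ubound; exists set0; first exact: well_inside0.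
by rewrite lam0.
Qed.

Let inner_le1 V : (inner V <= 1)%E.
Proof. by apply: ge_ereal_sup => _ [K _ <-]; rewrite lee_fin -lamT lam_homo. Qed.

Let inner_fin V : inner V \is a fin_num.
Proof.
rewrite ge0_fin_numE //; apply: le_lt_trans (inner_le1 V) _; exact: ltry.
Qed.

Let gauge_ge0 V : (0 <= gauge V)%E.
Proof. by rewrite /gauge; case: ifP => // _; exact: leey. Qed.

Let gauge0 : gauge set0 = 0%E.
Proof.
rewrite /gauge asboolT; last exact: open0.
apply/eqP; rewrite eq_le inner_ge0 andbT.
apply: ge_ereal_sup => _ [K [r r0 K0] <-].
have -> : K = set0 by apply/seteqP; split=> // x /K0 /(_ x (ballxx _ r0)).
by rewrite lam0.
Qed.

Let gaugeE V : open V -> gauge V = inner V.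
Proof. by move=> oV; rewrite /gauge asboolT. Qed.

Let mu : set X -> \bar R := @mu_ext _ (borel X) R gauge.

HB.instance Definition _ := isOuterMeasure.Build R X mu
  (@mu_ext0 _ (borel X) R gauge gauge0 gauge_ge0)
  (@mu_ext_ge0 _ (borel X) R gauge gauge_ge0)
  (@le_mu_ext _ (borel X) R gauge)
  (@mu_ext_sigma_subadditive _ (borel X) R gauge gauge_ge0).

Let mu_le_gauge V : (mu V <= gauge V)%E.
Proof.
rewrite /gauge; case: asboolP => [oV|_]; last exact: leey.
apply: ereal_inf_lbound; exists (fun n => if n is 0%N then V else set0).
  split.
    move=> [|i]; last exact: measurable0.
    by apply: sub_sigma_algebra.
  by move=> x Vx; exists 0%N.
rewrite nneseries_recl // eseries0 ?adde0; first exact: gaugeE.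
by case=> // n _ _; exact: gauge0.
Qed.

(** Take [K] well inside the intersection of [V] and [U], then [L] well inside [V] minus the closure
    of [K]. They are separated and their union is well inside [V], so [lam L + lam K] is at most
    [inner V]; suprema over [L], then over [K], give the bound. *)
Let gauge_split U V : open U ->
  (mu (V `&` U) + mu (V `&` ~` U) <= gauge V)%E.
Proof.
move=> oU; have [oV|nV] := pselect (open V); last first.
  by rewrite [leRHS]/gauge asboolF // leey.
rewrite (gaugeE oV).
have mu_fin A : mu A \is a fin_num.
  rewrite ge0_fin_numE; last exact: mu_ext_ge0.
  apply: (@le_lt_trans _ _ (mu setT)); first exact: le_mu_ext.
  apply: le_lt_trans (mu_le_gauge _) _; rewrite gaugeE; last exact: openT.
  by apply: le_lt_trans (inner_le1 _) _; exact: ltry.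
apply: (@le_trans _ _ (inner (V `&` U) + mu (V `&` ~` U))%E).
  by rewrite leeD2r // -gaugeE; [exact: mu_le_gauge | exact: openI].
rewrite -leeBrDr //; apply: ge_ereal_sup => _ [K [r r0 KVU] <-].
rewrite leeBrDr // addeC -leeBrDr //.
have oVK : open (V `&` ~` closure K).
  by apply: openI => //; apply: closed_openC; exact: closed_closure.
have clKU : closure K `<=` U.
  move=> x /(_ (ball x r)) [|y [Ky xy]]; first exact: nbhsx_ballx.
  by case: (KVU y Ky x) => //; exact: ball_sym.
apply: (@le_trans _ _ (inner (V `&` ~` closure K))).
  rewrite -gaugeE //; apply: le_trans (mu_le_gauge _).
  by apply: le_mu_ext; apply: setIS; exact: subsetC.
apply: ge_ereal_sup => _ [L [s s0 LVK] <-].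
rewrite leeBrDr // -EFinD.
apply: (@le_trans _ _ (lam (L `|` K))%:E).
  rewrite lee_fin; apply: (lam_separated s0) => x y Lx Ky xy.
  by have [_] := LVK x Lx y xy; apply; exact: subset_closure.
apply: ereal_sup_ubound; exists (L `|` K) => //.
exists (Num.min r s); first by rewrite lt_min r0.
move=> x [Lx|Kx] y xy.
- suff /(LVK x Lx)[] : ball x s y by [].
  by apply: le_ball xy; rewrite ge_min lexx orbT.
- suff /(KVU x Kx)[] : ball x r y by [].
  by apply: le_ball xy; rewrite ge_min lexx.
Qed.

(** The inequality [gauge_split] is summed over a cover of [A], with countable subadditivity on both
    pieces. *)
Let mu_open U : open U -> caratheodory_measurable mu U.
Proof.
move=> oU; apply: le_caratheodory_measurable => A.
apply: le_ereal_inf_tmp => _ [F [_ AF] <-].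
have : (\sum_(n <oo) (mu (F n `&` U) + mu (F n `&` ~` U)) <=
    \sum_(n <oo) gauge (F n))%E.
  apply: lee_nneseries => [n _ _|n _]; last exact: gauge_split.
  by rewrite adde_ge0 //; exact: outer_measure_ge0.
apply: le_trans; rewrite nneseriesD; last 2 first.
  by move=> *; exact: outer_measure_ge0.
  by move=> *; exact: outer_measure_ge0.
have sub B : (mu (A `&` B) <= \sum_(n <oo) mu (F n `&` B))%E.
  apply: le_trans (outer_measure_sigma_subadditive mu _).
  apply: le_outer_measure => x [/AF[n _ Fx] Bx]; by exists n.
by apply: leeD; exact: sub.
Qed.

(** Lebesgue's number lemma; compactness lets one [N] serve both as bound on the indices and as
    inverse radius. *)
Let lebesgue_number (F : nat -> set X) : (forall n, open (F n)) ->
  [set: X] `<=` \bigcup_n F n ->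
  exists N, forall x, exists2 n, (n < N)%N & ball x N.+1%:R^-1 `<=` F n.
Proof.
move=> oF XF.
have /compact_near_coveringP := X_compact.
move=> /(_ nat \oo (fun N x => exists2 n, (n < N)%N & ball x N.+1%:R^-1 `<=` F n)).
case.
  move=> x _; have [n _ Fnx] := XF x I.
  have /nbhs_ballP[e /= e0 xe] : nbhs x (F n) by exact: open_nbhs_nbhs.
  have e20 : 0 < e / 2 by rewrite divr_gt0.
  near=> y N.
  have Ne : N.+1%:R^-1 < e / 2.
    by near: N; exact: near_infty_natSinv_lt (PosNum e20).
  have xy : ball x (e / 2) y by near: y; exact: nbhsx_ballx.
  rewrite /=; exists n; first by near: N; exact: nbhs_infty_gt.
  move=> z yz; apply: xe; rewrite [e]splitr.
  apply: (ball_triangle (y := y)); last exact: le_ball (ltW Ne) _ yz.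
  exact: xy.
move=> N _ /(_ N (leqnn N)) H.
by exists N => x; exact: H.
Unshelve. all: by end_near. Qed.

Let lam_bigcup (F : nat -> set X) N :
  lam (\bigcup_(i < N) F i) <= \sum_(i < N) lam (F i).
Proof.
rewrite bigcup_mkord; elim: N => [|N IH]; first by rewrite !big_ord0 lam0.
rewrite !big_ord_recr /=; apply: le_trans (lamU _ _) _.
by rewrite lerD2r.
Qed.

Let mu_setT : mu setT = 1%E.
Proof.
apply/eqP; rewrite eq_le; apply/andP; split.
  apply: le_trans (mu_le_gauge _) _.
  by rewrite gaugeE; [exact: inner_le1 | exact: openT].
apply: le_ereal_inf_tmp => _ [F [_ XF] <-].
have [oF|] := pselect (forall n, open (F n)); last first.
  move=> /existsNP[n nF].
  rewrite (eseries_pinfty _ _ (_ : gauge (F n) = +oo%E)) ?leey //.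
    move=> m _; rewrite -ltNye; apply: lt_le_trans (gauge_ge0 _).
    exact: ltNyr.
  by rewrite /gauge asboolF.
have [N HN] := lebesgue_number oF XF.
(* [G n] is well inside [F n] with margin [1/(N+1)], and the first [N] of these sets still cover
   [X]; finite subadditivity of [lam] then bounds the sum of the gauges below by 1. *)
pose G n := [set x | ball x N.+1%:R^-1 `<=` F n].
have XG : [set: X] `<=` \bigcup_(i < N) G i.
  by move=> x _; have [n nN xF] := HN x; exists n.
apply: (@le_trans _ _ (\sum_(0 <= i < N) gauge (F i))%E); last first.
  by apply: nneseries_lim_ge => n _ _.
apply: (@le_trans _ _ (\sum_(i < N) lam (G i))%:E).
  by rewrite lee_fin -lamT; apply: le_trans (lam_homo XG) _; exact: lam_bigcup.
rewrite big_mkord -sumEFin; apply: lee_sum => i _; rewrite gaugeE //.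
apply: ereal_sup_ubound; exists (G i) => //.
by exists N.+1%:R^-1.
Qed.

(** Uniform continuity of [h] turns a margin [r] in the preimage of [V] into a margin [d] in [V], so
    the gauge does not grow under preimage by [g]; open covers are then pulled back along [g]. *)
Let mu_preimage (g h : X -> X) : cancel g h -> cancel h g -> continuous g ->
  (forall e, 0 < e -> exists2 d : R, 0 < d &
    forall x y, ball x d y -> ball (h x) e (h y)) ->
  (forall A, lam (g @^-1` A) <= lam A) ->
  forall A, (mu (g @^-1` A) <= mu A)%E.
Proof.
move=> gh hg cg uh glam A.
have gauge_pre V : (gauge (g @^-1` V) <= gauge V)%E.
  have [oV|nV] := pselect (open V); last by rewrite [leRHS]/gauge asboolF // leey.
  rewrite !gaugeE //; last by apply: open_comp => // x _; exact: cg.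
  apply: ge_ereal_sup => _ [K [r r0 KV] <-].
  apply: (@le_trans _ _ (lam (h @^-1` K))%:E).
    rewrite lee_fin; apply: le_trans (glam _).
    by apply: lam_homo => x Kx /=; rewrite gh.
  apply: ereal_sup_ubound; exists (h @^-1` K) => //.
  have [d d0 hd] := uh _ r0; exists d => // x Kx y xy.
  by have := KV _ Kx _ (hd _ _ xy); rewrite /= hg.
apply: le_ereal_inf_tmp => _ [F [_ AF] <-].
have [oF|] := pselect (forall n, open (F n)); last first.
  move=> /existsNP[n nF].
  rewrite (eseries_pinfty _ _ (_ : gauge (F n) = +oo%E)) ?leey //.
    move=> m _; rewrite -ltNye; apply: lt_le_trans (gauge_ge0 _).
    exact: ltNyr.
  by rewrite /gauge asboolF.
apply: (@le_trans _ _ (\sum_(n <oo) gauge (g @^-1` F n))%E); last first.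
  by apply: lee_nneseries => // n _; exact: gauge_pre.
apply: ereal_inf_lbound; exists (fun n => g @^-1` F n) => //; split.
- move=> n; apply: sub_sigma_algebra; apply: open_comp => // x _; exact: cg.
- by move=> x /AF[n _ Fx]; exists n.
Qed.

Lemma regular_extension_exists : exists P : probability (borel X) R,
  forall g h : X -> X, cancel g h -> cancel h g -> continuous g ->
  (forall e, 0 < e -> exists2 d : R, 0 < d &
    forall x y, ball x d y -> ball (h x) e (h y)) ->
  (forall A, lam (g @^-1` A) <= lam A) ->
  forall A : set X, (P (g @^-1` A) <= P A)%E.
Proof.
have [P PE] := borel_probability_of_outer mu_open mu_setT.
exists P => g h gh hg cg uh glam A; rewrite !PE; exact: mu_preimage uh glam A.
Qed.

End regular_extension.

Lemma finite_subcover (R : realType) (X : pseudoPMetricType R) (e : R) :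
  compact [set: X] -> 0 < e -> exists s : seq (set X),
    {in s, forall C, exists x, C = ball x e} /\
    [set: X] `<=` \bigcup_(C in [set` s]) C.
Proof.
rewrite compact_cover => cX e0.
(* Interiors are used because balls are not assumed open. *)
have [] := cX X setT (fun x => (ball x e)°).
- by move=> x _; exact: open_interior.
- by move=> x _; exists x => //; exact: nbhsx_ballx.
move=> D _ XD; exists [seq ball x e | x <- finmap.enum_fset D]; split.
  by move=> C /mapP[x _ ->]; exists x.
move=> y /XD[x /= xD xy]; exists (ball x e); last exact: interior_subset.
by apply/mapP; exists x.
Qed.

(** The covering sets are those all of whose preimages under words are small, a family stable under
    preimage by each [f i]. Equicontinuity of the inverse words puts all sufficiently small balls in
    it. *)
Lemma invariant_probability (R : realType) (X : pseudoPMetricType R) (k : nat)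
    (f : 'I_k -> X -> X) :
  compact [set: X] -> (forall i, homeomorphism (f i)) ->
  (forall e, 0 < e -> exists2 d : R, 0 < d & forall w x y,
    ball (word_action f w x) d (word_action f w y) -> ball x e y) ->
  exists nu : probability (borel X) R, common_invariant f nu.
Proof.
move=> cX fh eqc.
pose S e : set (set X) := [set C | forall w x y,
  C (word_action f w x) -> C (word_action f w y) -> ball x e y].
have S_pre i e C : S e C -> S e (f i @^-1` C).
  by move=> SC w x y; rewrite /= -!word_action_rcons; exact: SC.
have [|e e0|lam [lam0 lamT lamS lamU [lam_sep lam_pre]]] := @content_exists R X S.
- by move=> e C x y SC Cx Cy; exact: (SC [::]).
- have [d d0 eqcd] := eqc _ e0.
  have [|s [sB sX]] := @finite_subcover R X (d / 2) cX; first by rewrite divr_gt0.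
  exists s; split=> // C /sB[x ->] w y z xy xz; apply: (eqcd w).
  by rewrite [d]splitr; apply: ball_triangle xz; exact: ball_sym.
have [nu nu_pre] := regular_extension_exists cX lam0 lamT lamS lamU lam_sep.
exists nu => i A mA; have [cf [g [fg gf cg]]] := fh i.
have nu_le (B : set X) : (nu (f i @^-1` B) <= nu B)%E.
  apply: (nu_pre (f i) g) => // [e e0|].
    have [d d0 eqcd] := eqc _ e0; exists d => // x y xy.
    by apply: (eqcd [:: i]); rewrite /= !gf.
  by move=> B'; apply: lam_pre => e C; exact: S_pre.
have mfA : measurable (f i @^-1` A : set (borel X)).
  have mf : measurable_fun setT (f i : borel X -> borel X).
    apply: (@measurability _ _ (borel X) (borel X) _ _ (@open X)) => //.
    move=> _ [U oU <-]; rewrite setTI; apply: sub_sigma_algebra.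
    by apply: open_comp => // x _; exact: cf.
  by rewrite -[_ @^-1` _]setTI; exact: mf.
(* For the complement of [A] the same inequality reads in the other direction, the total mass being
   1. *)
apply/eqP; rewrite eq_le nu_le /=.
have := nu_le (~` A); rewrite preimage_setC !probability_setC //.
by rewrite leeD2lE // leeN2.
Qed.

(** * Arcs and connected subsets of the circle *)

Section circle_topology.
Context {R : realType}.
Implicit Types p q : circle R.

Definition abscissa p : R := (\val p).1.
Definition ordinate p : R := (\val p).2.

Lemma circleE p : abscissa p ^+ 2 + ordinate p ^+ 2 = 1.
Proof. exact: set_mem (valP p). Qed.

Lemma circle_inj p q :
  abscissa p = abscissa q -> ordinate p = ordinate q -> p = q.
Proof.
move=> pq1 pq2; apply: val_inj; apply/eqP.
by rewrite /= -pair_eqE /=; apply/andP; split; apply/eqP.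
Qed.

Lemma circle_point (a b : R) : a ^+ 2 + b ^+ 2 = 1 ->
  exists p, abscissa p = a /\ ordinate p = b.
Proof. by move=> ab; exists (exist _ (a, b) (mem_set ab)). Qed.

Lemma ball_circleE p (e : R) q : ball p e q <->
  `|abscissa p - abscissa q| < e /\ `|ordinate p - ordinate q| < e.
Proof. by []. Qed.

Lemma continuous_abscissa : continuous abscissa.
Proof.
move=> p; apply: (@continuous_comp _ _ _ (set_val : circle R -> _) fst).
  exact: initial_continuous.
exact: cvg_fst.
Qed.

Lemma continuous_ordinate : continuous ordinate.
Proof.
move=> p; apply: (@continuous_comp _ _ _ (set_val : circle R -> _) snd).
  exact: initial_continuous.
exact: cvg_snd.
Qed.

Lemma rotation_subproof p (t : R) :
  (abscissa p * cos t - ordinate p * sin t,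
   ordinate p * cos t + abscissa p * sin t) \in unit_circle R.
Proof.
apply/mem_set; rewrite /unit_circle /=.
transitivity ((abscissa p ^+ 2 + ordinate p ^+ 2) * (cos t ^+ 2 + sin t ^+ 2)).
  by ring.
by rewrite circleE cos2Dsin2 mulr1.
Qed.

Definition rotation p t : circle R :=
  exist (fun x => x \in unit_circle R) _ (rotation_subproof p t).

Lemma continuous_rotation p : continuous (rotation p).
Proof.
apply: (@continuous_comp_initial (circle R) R (R * R)%type set_val) => t.
have cx : (abscissa p * cos u - ordinate p * sin u) @[u --> t] -->
    abscissa p * cos t - ordinate p * sin t.
  apply: cvgB; apply: cvgM; try exact: cvg_cst.
    exact: continuous_cos.
  exact: continuous_sin.
have cy : (ordinate p * cos u + abscissa p * sin u) @[u --> t] -->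
    ordinate p * cos t + abscissa p * sin t.
  apply: cvgD; apply: cvgM; try exact: cvg_cst.
    exact: continuous_cos.
  exact: continuous_sin.
exact: (cvg_pair cx cy).
Qed.

(** Together with [cross] below, the cosine and sine of the oriented angle from [p] to [q]. *)
Definition inner p q := abscissa p * abscissa q + ordinate p * ordinate q.
Definition cross p q := abscissa p * ordinate q - ordinate p * abscissa q.

Lemma inner2Dcross2 p q : inner p q ^+ 2 + cross p q ^+ 2 = 1.
Proof.
transitivity ((abscissa p ^+ 2 + ordinate p ^+ 2) *
  (abscissa q ^+ 2 + ordinate q ^+ 2)); last by rewrite !circleE mulr1.
by rewrite /inner /cross; ring.
Qed.

Lemma inner_itv p q : -1 <= inner p q <= 1.
Proof.
rewrite -ler_norml -(@expr_le1 _ 2) // real_normK ?num_real //.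
by rewrite -(inner2Dcross2 p q) lerDl sqr_ge0.
Qed.

Lemma cross_itv p q : -1 <= cross p q <= 1.
Proof.
rewrite -ler_norml -(@expr_le1 _ 2) // real_normK ?num_real //.
by rewrite -(inner2Dcross2 p q) lerDr sqr_ge0.
Qed.

Lemma rotation_angle p q t :
  cos t = inner p q -> sin t = cross p q -> rotation p t = q.
Proof.
rewrite /inner /cross => ct st.
apply: circle_inj.
  rewrite -[LHS]/(abscissa p * cos t - ordinate p * sin t) ct st.
  transitivity ((abscissa p ^+ 2 + ordinate p ^+ 2) * abscissa q); first by ring.
  by rewrite circleE mul1r.
rewrite -[LHS]/(ordinate p * cos t + abscissa p * sin t) ct st.
transitivity ((abscissa p ^+ 2 + ordinate p ^+ 2) * ordinate q); first by ring.
by rewrite circleE mul1r.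
Qed.

Lemma rotation0 p : rotation p 0 = p.
Proof.
apply: rotation_angle; rewrite ?cos0 ?sin0 /inner /cross; last by ring.
by rewrite -!expr2 circleE.
Qed.

(** The angle from [p] to [q] is the arccosine of [inner p q], with the sign of [cross p q]. *)
Lemma rotation_image p : rotation p @` `[- pi, pi] = setT.
Proof.
apply/seteqP; split=> // q _.
pose c := inner p q; pose s := cross p q.
have c1 : -1 <= c <= 1 := inner_itv p q.
have cosa : cos (acos c) = c by apply: acosK; rewrite in_itv.
have sina : sin (acos c) = `|s|.
  by rewrite sin_acos // -(inner2Dcross2 p q) addrC addKr sqrtr_sqr.
have a0 := acos_ge0 c1; have api := acos_lepi c1.
have [s0|s0] := leP 0 s.
  exists (acos c); last by apply: rotation_angle; rewrite ?cosa // sina ger0_norm.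
  by rewrite /= in_itv /= api andbT (le_trans _ a0) // oppr_le0 pi_ge0.
exists (- acos c).
  by rewrite /= in_itv /= lerN2 api /= (le_trans _ (pi_ge0 _)) // oppr_le0.
by apply: rotation_angle; rewrite ?cosN ?sinN ?cosa // sina ltr0_norm // opprK.
Qed.

Lemma compact_circle : compact [set: circle R].
Proof.
rewrite -(rotation_image point); apply: continuous_compact.
  by apply: continuous_subspaceT; exact: continuous_rotation.
exact: segment_compact.
Qed.

Lemma connected_rotation p a b : connected (rotation p @` `[a, b]).
Proof.
apply: connected_continuous_connected.
  by apply/connected_intervalP; exact: interval_is_interval.
by apply: continuous_subspaceT; exact: continuous_rotation.
Qed.

Lemma connected_circle : connected [set: circle R].
Proof. by rewrite -(rotation_image point); exact: connected_rotation. Qed.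

Lemma abscissa_le1 p : `|abscissa p| <= 1.
Proof.
by rewrite -(@expr_le1 _ 2) // real_normK ?num_real // -(circleE p) lerDl sqr_ge0.
Qed.

Lemma ordinate_le1 p : `|ordinate p| <= 1.
Proof.
by rewrite -(@expr_le1 _ 2) // real_normK ?num_real // -(circleE p) lerDr sqr_ge0.
Qed.

(** The set is an arc of rotations of [p] by angles at most [h]. It reaches [q] because, for nearby
    points, the angle from [p] to [q] is the arcsine of [cross p q]. *)
Lemma small_connected (e : R) : 0 < e -> exists2 d : R, 0 < d &
  forall p q, ball p d q -> exists A : set (circle R),
    [/\ connected A, A p, A q & A `<=` ball p e].
Proof.
move=> e0; have e20 : 0 < e / 2 by rewrite divr_gt0.
have [h h0 hP] : exists2 h : R, 0 < h & forall t, `|t| <= h ->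
    `|1 - cos t| < e / 2 /\ `|sin t| < e / 2.
  have /nbhs_ballP[r /= r0 rP] : \forall t \near (0 : R),
      `|1 - cos t| < e / 2 /\ `|sin t| < e / 2.
    apply: filterI.
      have /cvgrPdist_lt := @continuous_cos R 0; rewrite cos0; exact.
    have /cvgr0Pnorm_lt : sin t @[t --> (0 : R)] --> (0 : R).
      by rewrite -[X in _ --> X]sin0; exact: continuous_sin.
    exact.
  exists (r / 2); first by rewrite divr_gt0.
  move=> t tr; apply: rP; rewrite /ball /= sub0r normrN (le_lt_trans tr) //.
  by rewrite ltr_pdivrMr // mulr_natr mulr2n ltrDl.
have [d d0 dP] : exists2 d : R, 0 < d & forall s, `|s| < d -> `|asin s| <= h.
  have asin0 : asin (0 : R) = 0.
    by rewrite -{1}sin0 sinK // in_itv /= oppr_le0 divr_ge0 // pi_ge0.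
  have cas : asin s @[s --> (0 : R)] --> (0 : R).
    rewrite -[X in _ --> X]asin0; apply: continuous_asin.
    by rewrite ltrN10 ltr01.
  have /cvgr0Pnorm_le/(_ h h0)/nbhs_ballP[r /= r0 rP] := cas.
  by exists r => // s sr; apply: rP; rewrite /ball /= sub0r normrN.
(* The bound [1 / 2] makes [inner p q] non-negative, so that [asin] recovers the angle; the bound
   [d / 2] on both coordinates keeps [cross p q] below [d] in absolute value. *)
exists (Num.min (1 / 2) (d / 2)).
  by rewrite lt_min !divr_gt0.
move=> p q /ball_circleE[pq1 pq2].
pose c := inner p q; pose s := cross p q.
move: pq1 pq2; rewrite !lt_min => /andP[pq1 pqd1] /andP[pq2 pqd2].
have c0 : 0 <= c.
  have sq x : `|x| < 1 / 2 -> x ^+ 2 < 1 :> R.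
    move=> x1; rewrite -real_normK ?num_real // expr_lt1 //.
    by apply: lt_trans x1 _; lra.
  have := sq _ pq1; have := sq _ pq2.
  have := circleE p; have := circleE q; rewrite /c /inner; nra.
have sd : `|s| < d.
  have -> : s = ordinate p * (abscissa p - abscissa q) -
      abscissa p * (ordinate p - ordinate q) by rewrite /s /cross; ring.
  apply: le_lt_trans (ler_normB _ _) _; rewrite !normrM [d]splitr ltrD //.
    by apply: le_lt_trans pqd1; rewrite ler_piMl // ordinate_le1.
  by apply: le_lt_trans pqd2; rewrite ler_piMl // abscissa_le1.
have s1 : -1 <= s <= 1 := cross_itv p q.
have sina : sin (asin s) = s by apply: asinK; rewrite in_itv.
have cosa : cos (asin s) = c.
  by rewrite cos_asin // -(inner2Dcross2 p q) addrK sqrtr_sqr ger0_norm.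
exists (rotation p @` `[- h, h]); split.
- exact: connected_rotation.
- exists 0; first by rewrite /= in_itv /= oppr_le0 ltW.
  exact: rotation0.
- exists (asin s); first by rewrite /= in_itv /= -ler_norml; exact: dP.
  exact: rotation_angle.
- move=> _ [t + <-]; rewrite /= in_itv /= -ler_norml => /hP[ct st].
  have le1 (x y : R) : `|x| <= 1 -> `|y| < e / 2 -> `|x * y| < e / 2.
    by move=> x1 ye; rewrite normrM (le_lt_trans _ ye) // ler_piMl.
  apply/ball_circleE; rewrite {2}/abscissa {2}/ordinate /=; split.
    have -> : abscissa p - (abscissa p * cos t - ordinate p * sin t) =
      abscissa p * (1 - cos t) + ordinate p * sin t by ring.
    apply: le_lt_trans (ler_normD _ _) _; rewrite [e]splitr ltrD // le1 //.
      exact: abscissa_le1.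
    exact: ordinate_le1.
  have -> : ordinate p - (ordinate p * cos t + abscissa p * sin t) =
    ordinate p * (1 - cos t) - abscissa p * sin t by ring.
  apply: le_lt_trans (ler_normB _ _) _; rewrite [e]splitr ltrD // le1 //.
    exact: ordinate_le1.
  exact: abscissa_le1.
Qed.

End circle_topology.

(** * Connected subsets of the circle and strips *)

Section strips.
Context {R : realType} (X : topologicalType) (u v : X -> R).
Hypothesis u_cont : continuous u.
Hypothesis v_cont : continuous v.
Hypothesis uv1 : forall p, u p ^+ 2 + v p ^+ 2 = 1.
Hypothesis uv_inj : forall p q, u p = u q -> v p = v q -> p = q.
Hypothesis uv_surj : forall a b, a ^+ 2 + b ^+ 2 = 1 ->
  exists p, u p = a /\ v p = b.

(** The coordinates [u] and [v] are abstract so that strips can be cut across either axis. *)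
Definition strip (s t : R) (up : bool) : set X :=
  [set p | [/\ s < u p, u p < t & if up then 0 < v p else v p < 0]].

Lemma open_strip s t up : open (strip s t up).
Proof.
have -> : strip s t up = u @^-1` [set y | s < y] `&` u @^-1` [set y | y < t] `&`
    v @^-1` (if up then [set y | 0 < y] else [set y | y < 0]).
  by apply/seteqP; split=> [p []|p [[]]]; rewrite /strip /=; case: up.
apply: openI; [apply: openI|]; apply: open_comp.
- by move=> x _; exact: u_cont.
- exact: open_gt.
- by move=> x _; exact: u_cont.
- exact: open_lt.
- by move=> x _; exact: v_cont.
- by case: up; [exact: open_gt | exact: open_lt].
Qed.

Lemma strip_nonempty s t up : -1 <= s -> s < t -> t <= 1 -> strip s t up !=set0.
Proof.
move=> s1 st t1; pose z := (s + t) / 2.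
have z1 : z ^+ 2 < 1 by rewrite /z; nra.
pose b := Num.sqrt (1 - z ^+ 2).
have b0 : 0 < b by rewrite sqrtr_gt0 subr_gt0.
have zb : z ^+ 2 + b ^+ 2 = 1 by rewrite sqr_sqrtr ?subr_ge0 ?ltW // addrC subrK.
have [|p [uz vz]] := @uv_surj z (if up then b else - b).
  by case: (up); rewrite ?sqrrN.
exists p; rewrite /strip /= uz vz; split; [rewrite /z; lra|rewrite /z; lra|].
by case: (up); rewrite ?oppr_lt0.
Qed.

(* Two missing points, one in each half of the strip, would cut the circle
   along a graph [u = c(v)] separating [x] from [y]. *)
Lemma connected_contains_strip (C : set X) x y s t :
  connected C -> C x -> C y -> u x <= s -> s < t -> t <= u y ->
  exists up, strip s t up `<=` C.
Proof.
move=> cC Cx Cy xs st ty; apply: contrapT => /forallNP noC.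
have /existsNP[a /not_implyP[[sa ta va] nCa]] := noC true.
have /existsNP[b /not_implyP[[sb tb vb] nCb]] := noC false.
(* In the plane, [psi] vanishes on the chord from [b] to [a] prolonged by vertical half-lines below
   [b] and above [a]; [x] and [y] lie on opposite sides of this graph. *)
pose clip (z : R) := Num.min 1 (Num.max 0 z).
pose psi p := u p - (u b + (u a - u b) * clip ((v p - v b) / (v a - v b))).
have vab : 0 < v a - v b by rewrite subr_gt0; exact: lt_trans vb va.
have clip01 z : 0 <= clip z <= 1.
  by rewrite le_min ler01 le_max lexx /= ge_min lexx.
have cclip : continuous clip.
  have cmax : continuous ((fun=> 0) \max id : R -> R).
    move=> z; apply: continuous_max; [exact: cvg_cst | exact: cvg_id].
  have cmin : continuous ((fun=> 1) \min ((fun=> 0) \max id) : R -> R).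
    move=> z; apply: continuous_min; [exact: cvg_cst | exact: cmax].
  exact: cmin.
have cpsi : continuous psi.
  move=> p; apply: cvgB; first exact: u_cont.
  apply: cvgD; first exact: cvg_cst.
  apply: cvgM; first exact: cvg_cst.
  apply: (@continuous_comp _ _ _ (fun p => (v p - v b) / (v a - v b)) clip).
    apply: cvgM; last exact: cvg_cst.
    by apply: cvgB; [exact: v_cont | exact: cvg_cst].
  exact: cclip.
have psix : psi x <= 0.
  have /andP[c0 c1] := clip01 ((v x - v b) / (v a - v b)).
  rewrite /psi; nra.
have psiy : 0 <= psi y.
  have /andP[c0 c1] := clip01 ((v y - v b) / (v a - v b)).
  rewrite /psi; nra.
have /connected_intervalP itv : connected (psi @` C).
  apply: connected_continuous_connected => //.
  exact: continuous_subspaceT.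
have [p Cp psip] : (psi @` C) 0.
  by apply: (itv (psi x) (psi y)); [exists x|exists y|rewrite psix psiy].
have {psip} up : u p = u b + (u a - u b) * clip ((v p - v b) / (v a - v b)).
  by apply/eqP; rewrite -subr_eq0; apply/eqP.
(* A half-line meets the circle only at its end point [b] or [a], which is not in [C]. *)
have [vpb|vbp] := leP (v p) (v b).
  apply: nCb; suff -> : b = p by [].
  have pub : u p = u b.
    have z0 : (v p - v b) / (v a - v b) <= 0.
      by rewrite pmulr_lle0 ?invr_gt0 // subr_le0.
    by rewrite up /clip (max_l z0) min_r // mulr0 addr0.
  apply: uv_inj => //.
  have := uv1 p; have := uv1 b; rewrite pub; nra.
have [vap|vpa] := leP (v a) (v p).
  apply: nCa; suff -> : a = p by [].
  have pua : u p = u a.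
    have z1 : 1 <= Num.max 0 ((v p - v b) / (v a - v b)).
      by rewrite le_max ler_pdivlMr // mul1r lerD2r vap orbT.
    by rewrite up /clip (min_l z1) mulr1 addrC subrK.
  apply: uv_inj => //.
  have := uv1 p; have := uv1 a; rewrite pua; nra.
(* Strictly between the ends of the chord, strict convexity of the disc gives
   [u p ^+ 2 + v p ^+ 2 < 1]. *)
pose z := (v p - v b) / (v a - v b).
have z0 : 0 < z by rewrite divr_gt0 // subr_gt0.
have z1 : z < 1 by rewrite ltr_pdivrMr // mul1r ltrD2r.
have vp : v p = v b + (v a - v b) * z.
  by rewrite /z mulrCA divff ?gt_eqF // mulr1 addrC subrK.
have clipz : clip z = z by rewrite /clip max_r ?min_r ?ltW.
move: up; rewrite -/z clipz => up.
have := uv1 p; have := uv1 a; have := uv1 b.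
have : 0 < z * (1 - z) * (v a - v b) ^+ 2.
  by rewrite mulr_gt0 ?exprn_gt0 // mulr_gt0 // subr_gt0.
have : 0 <= z * (1 - z) * (u a - u b) ^+ 2.
  by rewrite mulr_ge0 ?sqr_ge0 // mulr_ge0 ?subr_ge0 // ltW.
move=> h1 h2 h3 h4.
have -> : u p ^+ 2 + v p ^+ 2 = z * (u a ^+ 2 + v a ^+ 2) +
    (1 - z) * (u b ^+ 2 + v b ^+ 2) -
    (z * (1 - z) * (u a - u b) ^+ 2 + z * (1 - z) * (v a - v b) ^+ 2).
  by rewrite up vp; ring.
rewrite h3 h4; lra.
Qed.

Lemma finite_strips (e : R) : 0 < e -> exists s : seq (set X),
  {in s, forall U, open U /\ U !=set0} /\
  forall C x y, connected C -> C x -> C y -> u x + e <= u y ->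
    exists2 U, U \in s & U `<=` C.
Proof.
move=> e0.
(* The interval [[-1, 1]] is cut into more than [4 / e] steps of length [h], so that two consecutive
   steps are shorter than [e]. *)
have [N Ne] : exists N, 4 / e < N.+1%:R.
  exists (Num.truncn (4 / e)); exact: truncnS_gt.
pose h : R := 2 / N.+1%:R.
have h0 : 0 < h by rewrite divr_gt0.
have he : h * 2 < e.
  move: Ne; rewrite ltr_pdivrMr // => Ne.
  by rewrite /h mulrAC ltr_pdivrMr //; lra.
pose g j : R := - 1 + j%:R * h.
have gS j : g j.+1 = g j + h by rewrite /g -natr1; ring.
have gN : g N.+1 = 1.
  by rewrite /g /h mulrCA divff // mulr1; lra.
pose S := [seq strip (g ju.1) (g ju.1.+1) ju.2 |
  ju <- [seq (j, up) | j <- iota 0 N.+1, up <- [:: true; false]]].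
exists S; split.
  move=> U /mapP[[j up] /allpairsP[[j' up'] [jN _ [-> ->]]] ->]; split.
    exact: open_strip.
  move: jN; rewrite mem_iota add0n [X in (X < _)%N]/= => jN.
  apply: strip_nonempty.
  - by rewrite lerDl mulr_ge0 // ltW.
  - by rewrite gS ltrDl.
  - by rewrite -gN lerD2l ler_pM2r // ler_nat.
move=> C x y cC Cx Cy xy.
have u1 p : -1 <= u p <= 1.
  by rewrite -ler_norml -(@expr_le1 _ 2) // real_normK ?num_real // -(uv1 p) lerDl sqr_ge0.
have exj : exists j, u x <= g j by exists N.+1; rewrite gN; have /andP[] := u1 x.
(* The first grid value not below [u x] exceeds it by less than [h], so the next one is still at
   most [u y]. *)
case: (ex_minnP exj) => j xj jmin.
have gx : g j < u x + h.
  case: j xj jmin => [_ _|j _ jmin].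
    rewrite /g mul0r addr0; have /andP[] := u1 x; lra.
  rewrite gS ltrD2r ltNge; apply/negP => /jmin; by rewrite ltnn.
have gy : g j.+1 <= u y by rewrite gS; lra.
have gj : g j < g j.+1 by rewrite gS ltrDl.
have [up stC] := connected_contains_strip cC Cx Cy xj gj gy.
exists (strip (g j) (g j.+1) up) => //; apply/mapP; exists (j, up) => //.
apply/allpairsP; exists (j, up); split; last 1 first.
- by [].
- rewrite mem_iota add0n /= -(ltr_nat R) -(ltr_pM2r h0) -(ltrD2l (-1)).
  rewrite -/(g j) -/(g N.+1) gN.
  by have /andP[_] := u1 y; apply: lt_le_trans; exact: lt_le_trans gy.
- by case: (up).
Qed.

End strips.

(** * Contraction of an open set or equicontinuity of the inverses *)

Section circle_dichotomy.
Context {R : realType}.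

(** Points that are not [e]-close differ by at least [e] in one coordinate, so the strips for both
    axes together suffice. *)
Lemma circle_finite_test_sets (e : R) : 0 < e ->
  exists s : seq (set (circle R)),
  {in s, forall U, open U /\ U !=set0} /\
  forall C x y, connected C -> C x -> C y -> ~ ball x e y ->
    exists2 U, U \in s & U `<=` C.
Proof.
move=> e0.
have [s1 [oS1 S1]] := finite_strips (@continuous_abscissa R) continuous_ordinate
  circleE circle_inj circle_point e0.
have [|||s2 [oS2 S2]] := finite_strips (@continuous_ordinate R)
  continuous_abscissa _ _ _ e0.
- by move=> p; rewrite addrC circleE.
- by move=> p q ? ?; exact: circle_inj.
- by move=> a b; rewrite addrC => /circle_point[p [? ?]]; exists p.
exists (s1 ++ s2); split=> [U|C x y cC Cx Cy nxy].
  by rewrite mem_cat => /orP[/oS1|/oS2].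
have far (w : circle R -> R) a b : ~ `|w a - w b| < e ->
    w a + e <= w b \/ w b + e <= w a.
  move=> /negP; rewrite -leNgt ler_normr => /orP[|] ?; [right|left]; lra.
have {nxy} : ~ `|abscissa x - abscissa y| < e \/ ~ `|ordinate x - ordinate y| < e.
  by apply/not_andP => xy; exact: nxy.
case=> /far[] xy.
- have [U Us UC] := S1 C x y cC Cx Cy xy.
  by exists U => //; rewrite mem_cat Us.
- have [U Us UC] := S1 C y x cC Cy Cx xy.
  by exists U => //; rewrite mem_cat Us.
- have [U Us UC] := S2 C x y cC Cx Cy xy.
  by exists U => //; rewrite mem_cat Us orbT.
- have [U Us UC] := S2 C y x cC Cy Cx xy.
  by exists U => //; rewrite mem_cat Us orbT.
Qed.

(** Were the images of two distant points close, a small arc would join them. Its preimage under the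
    word is connected and contains both points, hence contains a test set, whose image would then be
    too small. *)
Lemma circle_expanding (k : nat) (f : 'I_k -> circle R -> circle R) :
  (forall i, homeomorphism (f i)) ->
  (forall U : set (circle R), open U -> U !=set0 -> exists2 d : R, 0 < d &
    forall w, exists x y, [/\ U x, U y &
      ~ ball (word_action f w x) d (word_action f w y)]) ->
  forall e, 0 < e -> exists2 d : R, 0 < d & forall w x y,
    ball (word_action f w x) d (word_action f w y) -> ball x e y.
Proof.
move=> fh noncontr e e0.
have [s [sU sC]] := circle_finite_test_sets e0.
have [d0 d00 d0P] : exists2 d0 : R, 0 < d0 & {in s, forall U : set (circle R),
    forall w, exists x y, [/\ U x, U y &
      ~ ball (word_action f w x) d0 (word_action f w y)]}.
  elim: s sU {sC} => [_|U s IH sU]; first by exists 1.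
  have [|d d0 dP] := IH; first by move=> V Vs; apply: sU; rewrite inE Vs orbT.
  have [oU U0] := sU U (mem_head _ _).
  have [d' d'0 d'P] := noncontr U oU U0.
  exists (Num.min d d'); first by rewrite lt_min d0.
  move=> V; rewrite inE => /predU1P[->|Vs] w.
    have [x [y [Ux Uy nxy]]] := d'P w; exists x, y; split=> // xy.
    by apply: nxy; apply: le_ball xy; rewrite ge_min lexx orbT.
  have [x [y [Ux Uy nxy]]] := dP V Vs w; exists x, y; split=> // xy.
  by apply: nxy; apply: le_ball xy; rewrite ge_min lexx.
have [|d dpos dP] := @small_connected R (d0 / 2); first by rewrite divr_gt0.
exists d => // w x y wxy; apply: contrapT => nxy.
have [cw [g [wg gw cg]]] := word_action_homeomorphism w fh.
have [A [cA Ax Ay Asmall]] := dP _ _ wxy.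
have cC : connected (g @` A).
  by apply: connected_continuous_connected => //; exact: continuous_subspaceT.
have [U Us UC] : exists2 U, U \in s & U `<=` g @` A.
  apply: (sC _ x y) => //.
    by exists (word_action f w x).
  by exists (word_action f w y).
have [a [b [/UC[a' Aa' <-] /UC[b' Ab' <-]]]] := d0P U Us w.
apply; rewrite !gw [d0]splitr; apply: ball_triangle (Asmall _ Ab').
by apply: ball_sym; exact: Asmall.
Qed.

End circle_dichotomy.

Theorem proposition3p9 (R : realType) (k : nat)
    (f : 'I_k -> circle R -> circle R)
    (f_homeo : forall i : 'I_k, homeomorphism (f i))
    (f_noninv : ~ exists nu : probability (borel (circle R)) R,
                    common_invariant f nu)
    (f_minimal : forward_minimal f) :
  strict_attractor f [set: circle R].
Proof.
have [i0|k0] := pselect (exists i0 : 'I_k, True); last first.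
  (* Without maps every probability measure is invariant, for instance a Dirac mass. *)
  case: f_noninv; exists (@dirac _ (borel (circle R)) point R) => i.
  by case: k0; exists i.
case: i0 => i0 _; apply: contrapT => not_attractor; apply: f_noninv.
apply: invariant_probability; [exact: compact_circle | exact: f_homeo |].
apply: circle_expanding => // U oU U0; apply: contrapT => no_bound.
apply: not_attractor.
apply: (@strict_attractor_of_contraction _ _ _ f i0 U) => //.
- exact: compact_circle.
- exact: connected_circle.
(* If no word contracted [U] to scale [e], then [e] would be a lower bound of the kind excluded by
   [no_bound]. *)
move=> e e0; apply: contrapT => no_word; apply: no_bound; exists e => // w.
apply: contrapT => no_pair; apply: no_word; exists w => x y Ux Uy.
by apply: contrapT => nxy; apply: no_pair; exists x, y.
Qed.
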